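(* If $X$ is a topological space that is a wqo, then the specialization preordering on $X^{\leq\omega}$ (with the asymptotic subword topology) is the subword preordering $\leq^\omega$.
   Context: The specialization preordering of a space is defined by $x \leq y$ iff every open neighborhood of $x$ contains $y$. A topological space is called a wqo if its topology is the Alexandroff topology (all upwards-closed subsets) of a well-quasi-ordering; a well-quasi-ordering is a reflexive transitive relation $\leq$ such that every infinite sequence $(x_n)_{n\in\mathbb{N}}$ has indices $m<n$ with $x_m \leq x_n$. $X^{\leq\omega}$ is the set of finite or infinite words over $X$, viewed as functions $w$ from an initial segment $\mathrm{dom}\, w$ of $\mathbb{N}$ to $X$. With $\leq$ the specialization preordering of $X$, $w \leq^\omega w'$ iff there is a strictly increasing map $f : \mathrm{dom}\, w \to \mathrm{dom}\, w'$ with $w_n \leq w'_{f(n)}$ for every $n \in \mathrm{dom}\, w$. For open subsets $U_1, \ldots, U_n, U$ of $X$ ($n \in \mathbb{N}$), $\langle U_1; \cdots; U_n\rangle$ is the set of finite or infinite words containing a letter in $U_1$, then at a later position a letter in $U_2$, and so on, until a letter in $U_n$ (for $n=0$, all words); $\langle U_1; \cdots; U_n; (\infty) U\rangle$ is the set of words that can be written as $uw$ with $u$ a finite word in $\langle U_1; \cdots; U_n\rangle$ and $w$ having letters from $U$ at infinitely many positions. The asymptotic subword topology on $X^{\leq\omega}$ is generated by all these sets as subbasic open sets. *)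

(* Defs.v *)
From HB Require Import structures.
From mathcomp Require Import all_boot all_order all_classical.
From mathcomp Require Import topology_structure.

Set Implicit Arguments.
Unset Strict Implicit.
Unset Printing Implicit Defensive.

Local Open Scope classical_set_scope.

Definition specialization (T : topologicalType) (x y : T) : Prop :=
  forall U : set T, open U -> U x -> U y.

Definition well_quasi_order (T : Type) (R : T -> T -> Prop) : Prop :=
  [/\ forall x, R x x,
      forall x y z, R x y -> R y z -> R x z &
      forall u : nat -> T, exists m n, (m < n)%N /\ R (u m) (u n)].

Definition upward_closed (T : Type) (R : T -> T -> Prop) (U : set T) : Prop :=
  forall x y, R x y -> U x -> U y.

Definition wqo_space (X : topologicalType) : Prop :=
  exists R : X -> X -> Prop,
    well_quasi_order R /\ forall U : set X, open U <-> upward_closed R U.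

(* A function from an initial segment of nat to X: the n-th letter is
   [Some x], or [None] when n lies outside the domain. *)
Record word (X : Type) := Word {
  letter :> nat -> option X;
  letter_init : forall m n, (m <= n)%N -> letter n -> letter m }.

HB.instance Definition _ (X : Type) := gen_eqMixin (word X).
HB.instance Definition _ (X : Type) := gen_choiceMixin (word X).

Section Words.
Variable X : Type.
Implicit Types (s : seq X) (w : word X) (U : set X).

Definition dom w : set nat := [set n | w n].

Definition positions w U : set nat := [set n | exists2 x, w n = Some x & U x].

Lemma isSome_onth s n : onth s n = (n < size s)%N :> bool.
Proof. by elim: s n => [|x s IHs] [|n] //=; rewrite IHs. Qed.

Lemma fin_word_init s m n : (m <= n)%N -> onth s n -> onth s m.
Proof. by rewrite !isSome_onth; apply: leq_ltn_trans. Qed.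

Definition fin_word s : word X := Word (@fin_word_init s).

Definition cat_letter s w (n : nat) : option X :=
  if (n < size s)%N then onth s n else w (n - size s)%N.

Lemma cat_word_init s w m n :
  (m <= n)%N -> cat_letter s w n -> cat_letter s w m.
Proof.
rewrite /cat_letter => mn; case: (ltnP m (size s)) => [ms _|sm].
  by rewrite isSome_onth.
rewrite ltnNge (leq_trans sm mn) /=; apply: letter_init.
exact: leq_sub2r.
Qed.

Definition cat_word s w : word X := Word (@cat_word_init s w).

(* <U_1; ...; U_n> *)
Definition subword_set (n : nat) (U : 'I_n -> set X) : set (word X) :=
  [set w | exists p : 'I_n -> nat,
    {homo p : i j / (i < j)%N} /\ forall i, positions w (U i) (p i)].

(* <U_1; ...; U_n; (oo) V> *)
Definition subword_inf_set (n : nat) (U : 'I_n -> set X) (V : set X) :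
    set (word X) :=
  [set w | exists s w', [/\ w = cat_word s w',
    subword_set U (fin_word s) & infinite_set (positions w' V)]].

End Words.

Section AsymptoticSubword.
Variable X : topologicalType.

Definition asymptotic_subbase : set (set (word X)) :=
  [set A | exists (n : nat) (U : 'I_n -> set X), (forall i, open (U i)) /\
    (A = subword_set U \/
     exists V : set X, open V /\ A = subword_inf_set U V)].

HB.instance Definition _ :=
  isSubBaseTopological.Build (word X) asymptotic_subbase id.

Definition subword_le (w w' : word X) : Prop :=
  exists f : nat -> nat,
    [/\ set_fun (dom w) (dom w') f,
        {in dom w &, {homo f : i j / (i < j)%N}} &
        forall n x y, w n = Some x -> w' (f n) = Some y -> specialization x y].

End AsymptoticSubword.

(* Main.v *)
(** A word belongs to <U_1; ...; U_n; (oo) V> iff it belongs to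
    <U_1; ...; U_n> and has infinitely many letters in V, and both properties
    are transported by subword embeddings.  Conversely, in a wqo space all but
    finitely many letters of a word w lie below infinitely many letters of w:
    otherwise the exceptional letters would contain a bad sequence.  Hence, for
    some N, w belongs to the open sets <^w_0; ...; ^w_(N-1); (oo) ^w_n> for all
    letters w_n with n >= N, where ^x is the upward closure of x.  If w' belongs
    to these sets too, then w_0 ... w_(N-1) embeds in w', and the remaining
    letters of w are placed one after the other, since infinitely many
    positions of w' are available for each of them. *)

Require Import Defs.
From mathcomp Require Import all_boot all_order all_classical.
From mathcomp Require Import topology_structure.

Set Implicit Arguments.
Unset Strict Implicit.
Unset Printing Implicit Defensive.

Local Open Scope classical_set_scope.

Lemma infinite_set_natP (A : set nat) :
  infinite_set A <-> forall N, exists2 n, (N <= n)%N & A n.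
Proof.
split=> [infA N|unbA /finite_seqP[s As]].
  apply: contra_notP infA => noA; apply: sub_finite_set (finite_II N) => n An /=.
  by rewrite ltnNge; apply/negP => Nn; apply: noA; exists n.
have [n sn] := unbA (\max_(i <- s) i).+1.
rewrite As /= => ns; move: sn; rewrite ltnNge => /negP; apply.
exact: (leq_bigmax_seq (F := id)).
Qed.

Section Words.
Variable X : Type.
Implicit Types (s : seq X) (w : word X) (U V : set X).

Lemma word_ext w w' : w =1 w' -> w = w'.
Proof.
case: w w' => [l li] [l' li'] /= /funext ll'; case: _ / ll' in li' *.
by congr Word; apply: Prop_irrelevance.
Qed.

Lemma positions_dom w U n : positions w U n -> dom w n.
Proof. by case=> x wn _; rewrite /dom /= wn. Qed.

Lemma infinite_positions_dom w U n : infinite_set (positions w U) -> dom w n.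
Proof.
move=> /infinite_set_natP/(_ n)[m nm /positions_dom]; exact: letter_init.
Qed.

Lemma positions_cat s w U n :
  positions (cat_word s w) U (size s + n)%N <-> positions w U n.
Proof. by rewrite /positions /= /cat_letter ltnNge leq_addr addKn. Qed.

Lemma positions_cat_fin s w U n :
  (n < size s)%N -> positions (cat_word s w) U n <-> positions (fin_word s) U n.
Proof. by move=> ns; rewrite /positions /= /cat_letter ns. Qed.

Lemma infinite_positions_cat s w U :
  infinite_set (positions (cat_word s w) U) <-> infinite_set (positions w U).
Proof.
split=> /infinite_set_natP infU; apply/infinite_set_natP => N.
  have [n Nn] := infU (size s + N)%N.
  have sn : (size s <= n)%N by apply: leq_trans Nn; rewrite leq_addr.
  rewrite -(subnKC sn) => /positions_cat Un; exists (n - size s)%N => //.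
  by rewrite leq_subRL.
have [n Nn Un] := infU N; exists (size s + n)%N; last exact/positions_cat.
exact: leq_trans Nn (leq_addl _ _).
Qed.

Lemma word_split w N : (forall n, (n < N)%N -> dom w n) ->
  exists s w', size s = N /\ w = cat_word s w'.
Proof.
move=> wN; have w'_init m n : (m <= n)%N -> w (N + n)%N -> w (N + m)%N.
  by move=> mn; apply: letter_init; rewrite leq_add2l.
have [s [sN ws]] : exists s, size s = N /\ forall n, (n < N)%N -> w n = onth s n.
  case: N wN {w'_init} => [|N] wN; first by exists [::].
  (* The letter at position 0, available as the prefix is nonempty, serves as default for [nth]. *)
  have := wN 0%N isT; rewrite /dom /=; case: (w 0%N) => // x _.
  exists (mkseq (fun i => odflt x (w i)) N.+1); split; first exact: size_mkseq.
  move=> n nN; rewrite onthE (nth_map x) ?size_mkseq// nth_mkseq//.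
  by have := wN n nN; rewrite /dom /=; case: (w n).
exists s, (Word w'_init); split=> //; apply: word_ext => n /=.
rewrite /cat_letter sN; case: ltnP => [/ws //|Nn].
by rewrite /= subnKC.
Qed.

(** Prepending a finite word does not affect whether [V] is met infinitely often. Conversely, a word
    meeting [V] infinitely often is infinite, so it can be cut behind any finite set of chosen
    positions. *)
Lemma subword_inf_setE n (U : 'I_n -> set X) V :
  subword_inf_set U V =
  [set w | subword_set U w /\ infinite_set (positions w V)].
Proof.
apply/seteqP; split=> w /=.
  move=> [s [w' [-> [p [p_homo pU]] infV]]].
  split; last by move: infV => /infinite_positions_cat.
  exists p; split=> // i; apply/positions_cat_fin => //.
  by have /positions_dom := pU i; rewrite /dom /= isSome_onth.
move=> [[p [p_homo pU]] infV].
have [s [w' [sN ws]]] : exists s w',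
    size s = (\max_i p i).+1 /\ w = cat_word s w'.
  by apply: word_split => m _; apply: infinite_positions_dom infV.
rewrite {}ws in pU infV *; exists s, w'; split=> //; last first.
  by move: infV => /infinite_positions_cat.
exists p; split=> // i; apply/(positions_cat_fin w') => //.
by rewrite sN ltnS leq_bigmax.
Qed.

End Words.

Section WqoSequence.
Variables (X : Type) (R : X -> X -> Prop).
Hypothesis wqoR : well_quasi_order R.

Lemma wqo_seq_eventually (a : nat -> X) :
  exists N, forall n, (N <= n)%N -> infinite_set [set m | R (a n) (a m)].
Proof.
apply: contrapT => noN.
have bad N : exists nb : nat * nat, (N <= nb.1)%N /\
    forall m, (nb.2 <= m)%N -> ~ R (a nb.1) (a m).
  apply: contrapT => badN; apply: noN; exists N => n Nn.
  apply/infinite_set_natP => b; apply: contrapT => nob; apply: badN.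
  by exists (n, b); split=> // m bm Rnm; apply: nob; exists m.
have [g gP] := choice bad.
(* [g N] is an exceptional index at least [N], with a bound from which on no letter lies above its
   letter. [K] accumulates these bounds, so each new exceptional index exceeds all earlier bounds
   and the chosen letters form a bad sequence. *)
pose K := fix K k := if k is k'.+1 then maxn (K k') (g (K k')).2 else 0%N.
have K_homo : {homo K : i j / (i <= j)%N}.
  by apply: homo_leq => [//|? ? ?|i]; [exact: leq_trans|exact: leq_maxl].
have [_ _ /(_ (fun k => a (g (K k)).1))[k [l [kl]]]] := wqoR.
have [_] := gP (K k); apply.
have [Kl _] := gP (K l); apply: leq_trans Kl.
exact: leq_trans (leq_maxr _ _) (K_homo _ _ kl).
Qed.

(** For a finite word, [N] is its length and the second clause is vacuous; for an infinite word, [N]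
    comes from the result on sequences. *)
Lemma wqo_word_eventually (w : word X) :
  exists N, (forall n, (n < N)%N -> dom w n) /\
    forall n x, (N <= n)%N -> w n = Some x ->
      infinite_set (positions w (R x)).
Proof.
have [[n wn]|winf] := pselect (exists n, ~~ w n).
  have [N wN minN] := ex_minnP (ex_intro (fun n => ~~ w n) n wn).
  exists N; split=> [m|m x Nm wm].
    by rewrite ltnNge; apply: contraR => /negP wm; apply: minN; apply/negP.
  by rewrite (letter_init Nm) // wm in wN.
have /choice[a aw] n : exists x, w n = Some x.
  case wn: (w n) => [x|]; first by exists x.
  by case: winf; exists n; rewrite wn.
have [N infN] := wqo_seq_eventually a.
exists N; split=> [n _|n x Nn]; first by rewrite /dom /= aw.
rewrite aw => -[<-]; apply: sub_infinite_set (infN n Nn) => m Rnm.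
by exists (a m).
Qed.

End WqoSequence.

Section AsymptoticSubword.
Variable X : topologicalType.
Implicit Types (w : word X) (U V : set X).

Lemma subword_set_open n (U : 'I_n -> set X) :
  (forall i, open (U i)) -> open (subword_set U).
Proof.
move=> oU; exists [set subword_set U]; last by rewrite bigcup_set1.
by move=> _ ->; apply: (finI_from1 id); exists n, U; split=> //; left.
Qed.

Lemma subword_inf_set_open n (U : 'I_n -> set X) V :
  (forall i, open (U i)) -> open V -> open (subword_inf_set U V).
Proof.
move=> oU oV; exists [set subword_inf_set U V]; last by rewrite bigcup_set1.
move=> _ ->; apply: (finI_from1 id); exists n, U; split=> //; right.
by exists V.
Qed.

Lemma specialization_subbase w w' :
  (forall A, asymptotic_subbase A -> A w -> A w') -> specialization w w'.
Proof.
move=> sub _ [F F_base <-] [A FA Aw]; exists A => //.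
have [B Bsub AB] := F_base _ FA; rewrite -AB in Aw *.
by move=> C BC; apply: sub (Aw C BC); have := Bsub _ BC; rewrite inE.
Qed.

Lemma subword_le_specialization w w' :
  subword_le w w' -> specialization w w'.
Proof.
move=> [f [f_dom f_homo f_le]].
have f_pos U n : open U -> positions w U n -> positions w' U (f n).
  move=> oU wU; have := f_dom _ (positions_dom wU); case: wU => x wn Ux.
  rewrite /dom /=; case w'n: (w' (f n)) => [y|//] _.
  by exists y => //; apply: f_le w'n U oU Ux.
have f_sub n (U : 'I_n -> set X) :
    (forall i, open (U i)) -> subword_set U w -> subword_set U w'.
  move=> oU [p [p_homo pU]]; exists (f \o p); split=> [i j ij|i]; last exact: f_pos.
  by apply: f_homo (p_homo _ _ ij); rewrite inE; apply: positions_dom.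
apply: specialization_subbase => _ [n [U [oU [->|[V [oV ->]]]]]]; first exact: f_sub.
rewrite subword_inf_setE => -[wU infV]; split; first exact: f_sub.
(* Infinitely many letters in [V] make the domain of [w] all of [nat]. So [f] is strictly increasing
   everywhere, whence [n <= f n], and images of positions in [V] pass every bound. *)
have f_incr : {homo f : i j / (i < j)%N}.
  by move=> i j; apply: f_homo; rewrite inE; apply: infinite_positions_dom infV.
have f_ge n' : (n' <= f n')%N.
  by elim: n' => // m IHm; apply: leq_ltn_trans IHm (f_incr _ _ (leqnn _)).
apply/infinite_set_natP => N; have /infinite_set_natP/(_ N)[m Nm wm] := infV.
by exists (f m); [apply: leq_trans Nm (f_ge m)|apply: f_pos].
Qed.

(** The set [R x] is open by transitivity and contains [x] by reflexivity, so [specialization x y]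
    puts [y] in it. *)
Lemma wqo_specializationE (R : X -> X -> Prop) : well_quasi_order R ->
  (forall U : set X, open U <-> upward_closed R U) ->
  @specialization X = R.
Proof.
move=> [Rrefl Rtrans _] openR; apply/funext => x; apply/funext => y.
apply/propext; split=> [xy|Rxy U /openR Uup]; last exact: Uup.
by apply: xy (Rrefl x); apply/openR => u v Ruv Rxu; apply: Rtrans Ruv.
Qed.

Lemma specialization_subword_le w w' : wqo_space X ->
  specialization w w' -> subword_le w w'.
Proof.
move=> [R [wqoR openR]] ww'.
have specR := wqo_specializationE wqoR openR.
have [Rrefl Rtrans _] := wqoR.
have oR x : open (R x) by apply/openR => u v Ruv Rxu; apply: Rtrans Ruv.
have [N [wN infN]] := wqo_word_eventually wqoR w.
(* The upward closure of the letter at [n], empty when [n] is outside the domain; this avoids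
   choosing a default letter. *)
pose up n : set X := [set y | exists2 x, w n = Some x & R x y].
have oup n : open (up n).
  apply/openR => u v Ruv [x wn Rxu]; exists x => //; exact: Rtrans Ruv.
have w_up : subword_set (fun i : 'I_N => up i) w.
  exists (fun i => i); split=> // i; have := wN i (ltn_ord i).
  by rewrite /dom /=; case wi: (w i) => [x|//] _; exists x => //; exists x.
have [p [p_homo p_up]] : subword_set (fun i : 'I_N => up i) w'.
  by apply: ww' w_up; apply: subword_set_open.
have inf_w' n x : (N <= n)%N -> w n = Some x -> infinite_set (positions w' (R x)).
  move=> Nn wn; have := ww' (subword_inf_set (fun i : 'I_N => up i) (R x)).
  rewrite subword_inf_setE => -[||//]; last by split=> //; apply: infN wn.
  by rewrite -subword_inf_setE; apply: subword_inf_set_open.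
pose q n := if insub n is Some i then p i else 0%N.
have qE n (nN : (n < N)%N) : q n = p (Ordinal nN) by rewrite /q insubT.
(* A pair consists of the index of the letter to place and the position of its predecessor. Below
   [N] the position is prescribed by [p]; from [N] on it must exceed the previous one. *)
have next (nm : nat * nat) : exists k, [/\ (nm.2 < k)%N || (nm.1 < N)%N,
    (nm.1 < N)%N -> k = q nm.1 &
    forall x, w nm.1 = Some x -> positions w' (R x) k].
  case: nm => n m /=; case: ltnP => [nN|Nn].
    exists (q n); split=> [|//|x wn]; first by rewrite orbT.
    have [y w'y [x' wn' Rx'y]] := p_up (Ordinal nN).
    by move: wn' Rx'y; rewrite /= wn => -[<-] Rxy; exists y; rewrite // qE.
  (* Outside the domain, [m.+1] keeps the map strictly increasing on all of [nat]. *)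
  case wn: (w n) => [x|]; last by exists m.+1; rewrite leqnn.
  have /infinite_set_natP/(_ m.+1)[k mk w'k] := inf_w' _ _ Nn wn.
  by exists k; rewrite mk; split=> // _ [<-].
have [h hP] := choice next.
pose f := fix f n := if n is n'.+1 then h (n, f n') else h (0, 0)%N.
have fh n : exists m, f n = h (n, m) by case: n => [|n]; eexists.
have f_up n x : w n = Some x -> positions w' (R x) (f n).
  by move=> wn; have [m ->] := fh n; have [_ _] := hP (n, m); apply.
have fq n : (n < N)%N -> f n = q n.
  by move=> nN; have [m ->] := fh n; have [_ ->] := hP (n, m).
have f_incr : {homo f : i j / (i < j)%N}.
  apply: homo_ltn => [? ? ?|n]; first exact: ltn_trans.
  (* If [n.+1] is below [N], both values come from the increasing [p]; otherwise, including the
     passage from [N - 1] to [N], the position was chosen beyond [f n]. *)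
  have [SnN|NSn] := ltnP n.+1 N; last first.
    by have [] := hP (n.+1, f n); rewrite /= [(n.+1 < N)%N]ltnNge NSn orbF.
  have nN : (n < N)%N by apply: ltnW.
  by rewrite !fq // !qE; apply: p_homo.
exists f; split=> [n|i j _ _|n x y wn w'n]; last 1 first.
- have [z] := f_up _ _ wn; rewrite w'n => -[<-]; by rewrite specR.
- by rewrite /dom /=; case wn: (w n) => [x|//] _; apply: positions_dom (f_up _ _ wn).
- exact: f_incr.
Qed.

End AsymptoticSubword.

Theorem proposition5p16 (X : topologicalType) (hX : wqo_space X)
  (w w' : word X) : specialization w w' <-> subword_le w w'.
Proof.
by split; [apply: specialization_subword_le|apply: subword_le_specialization].
Qed.
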